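(* Let $G$ be a graph and let $x$ be an eigenvector of the graph Laplacian $L(G)$ for the eigenvalue $\lambda$. Let $i$ be a vertex of $G$ that is connected only to $p$ soft nodes $s_1,\dots,s_p$ (so the neighbors of $i$ are exactly $s_1,\dots,s_p$, and $x_{s_1}=\dots=x_{s_p}=0$). Let $G'$ be the graph obtained from $G$ by replacing the vertex $i$ by a $d$-regular graph whose $k$ vertices are all connected to the $p$ soft nodes $s_1,\dots,s_p$. Then $\lambda=p$, and an eigenvector $x'$ of $L(G')$ for the eigenvalue $\lambda=p$ is formed by keeping $x'_m=x_m$ for every vertex $m\neq i$ of $G$ and assigning to each of the $k$ new vertices $j$ the value $x'_j=x_i/k$.
   Context: A graph has a finite vertex set and is connected, with no loops and no multiple edges (the $d$-regular graph that is inserted is a finite simple graph and need not be connected). The graph Laplacian of a graph with $n$ vertices is the $n\times n$ matrix $L$ with $L_{ij}=-1$ if $i\neq j$ and the edge $ij$ exists, $L_{ij}=0$ if $i\neq j$ and it does not, and $L_{ii}$ equal to the degree of $i$. A graph is $d$-regular if every vertex has degree $d$. A vertex $s$ is a soft node for an eigenvalue $\lambda$ if there is an eigenvector $x$ for $\lambda$ with $x_s=0$; here the soft nodes are taken with respect to the given eigenvector $x$. ''Replacing $i$'' means deleting $i$ and all its incident edges, adding the $k$ vertices and the edges of the $d$-regular graph, and adding all edges between these $k$ vertices and $s_1,\dots,s_p$; all other vertices and edges of $G$ are kept.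
   Formalization: The formal theorem adds the hypothesis that x_i is nonzero; without it the eigenvalue need not equal p (x may vanish at i and live elsewhere in G). It also makes k ≥ 1 explicit. *)

(* Defs.v *)
From mathcomp Require Import all_boot all_order all_algebra.

Set Implicit Arguments.
Unset Strict Implicit.
Unset Printing Implicit Defensive.

Import Order.TTheory GRing.Theory Num.Theory.
Local Open Scope ring_scope.

Record sgraph (n : nat) := SGraph {
  adj : rel 'I_n;
  adj_sym : symmetric adj;
  adj_irr : irreflexive adj
}.

Definition degree n (G : sgraph n) (v : 'I_n) : nat := #|[set w | adj G v w]|.

Definition connected_graph n (G : sgraph n) : Prop :=
  forall u v : 'I_n, connect (adj G) u v.

Definition regular n (G : sgraph n) (d : nat) : Prop :=
  forall v : 'I_n, degree G v = d.

Definition laplacian (R : numFieldType) n (G : sgraph n) : 'M[R]_n :=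
  \matrix_(i, j) if i == j then (degree G i)%:R
                 else if adj G i j then -1 else 0.

Definition eigenvector (R : numFieldType) n
    (A : 'M[R]_n) (a : R) (x : 'cV[R]_n) : Prop :=
  x != 0 /\ A *m x = a *: x.

(* Softness of s with respect to the given eigenvector x. *)
Definition soft_node (R : numFieldType) n (G : sgraph n)
    (a : R) (x : 'cV[R]_n) (s : 'I_n) : Prop :=
  eigenvector (laplacian R G) a x /\ x s 0 = 0.

Section Replace.

Variables (n k : nat) (G : sgraph n) (i : 'I_n) (S : {set 'I_n}) (H : sgraph k).

(* The vertices of the new graph are 'I_(n.-1 + k): the left summand 'I_n.-1
   enumerates the vertices of G other than i through lift i, and the right
   summand 'I_k is the vertex set of H. *)
Definition replace_adj : rel 'I_(n.-1 + k) := fun u v =>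
  match split u, split v with
  | inl a, inl b => adj G (lift i a) (lift i b)
  | inl a, inr _ => lift i a \in S
  | inr _, inl b => lift i b \in S
  | inr a, inr b => adj H a b
  end.

Lemma replace_adj_sym : symmetric replace_adj.
Proof.
move=> u v; rewrite /replace_adj.
by case: (split u) => a; case: (split v) => b //; rewrite adj_sym.
Qed.

Lemma replace_adj_irr : irreflexive replace_adj.
Proof. by move=> u; rewrite /replace_adj; case: (split u) => a; rewrite adj_irr. Qed.

Definition replace_vertex : sgraph (n.-1 + k) :=
  SGraph replace_adj_sym replace_adj_irr.

End Replace.

Definition replace_vector (R : numFieldType) n k (i : 'I_n) (x : 'cV[R]_n) :
    'cV[R]_(n.-1 + k) :=
  col_mx (\col_(m < n.-1) x (lift i m) 0) (\col_(j < k) (x i 0 / k%:R)).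
Arguments replace_vector {R n} k i x.

(* Main.v *)
Require Import Defs.
From mathcomp Require Import all_boot all_order all_algebra.

(** At a vertex [u], the Laplacian sums the differences [x u - x v] over the
    neighbors [v] of [u] ([laplacianE]).  If [x] vanishes on the neighbors of
    [u], every difference is [x u], so the value is [deg u * x u]
    ([laplacian_null_neighbors]).  At the vertex [i], where [x] is nonzero,
    this forces the eigenvalue to be [deg i = p].

    At an old vertex, the replacement does not change the value of the
    Laplacian ([laplacian_replace_old]).  Outside the soft set the neighbors
    and their values are the same.  A soft vertex, where [x] is zero, loses the
    term [- x i] and gains [k] terms [- x i / k]: dividing [x i] equally among
    the inserted vertices keeps the total.

    At an inserted vertex, the edges of [H] contribute nothing, since the
    vector is constant on them, and the [p] other neighbors are null: the
    equation for the eigenvalue [p] holds ([laplacian_replace_new]). *)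

Set Implicit Arguments.
Unset Strict Implicit.
Unset Printing Implicit Defensive.

Import Order.TTheory GRing.Theory Num.Theory.
Local Open Scope ring_scope.

Lemma sum_adj_const (V : pzSemiRingType) n (G : sgraph n) u (c : V) :
  \sum_(v | adj G u v) c = (degree G u)%:R * c.
Proof.
by rewrite mulr_natl -sumr_const; apply: eq_bigl => v; rewrite inE.
Qed.

Lemma sum_lift (V : nmodType) n (i : 'I_n) (P : pred 'I_n) (F : 'I_n -> V) :
  \sum_(v | P v) F v =
    (if P i then F i else 0) + \sum_(b | P (lift i b)) F (lift i b).
Proof.
by rewrite big_mkcond (bigD1_ord i) //= [in RHS]big_mkcond.
Qed.

(** The diagonal entry counts the neighbors of [u], so one copy of [x u] can be
    paired with each term [- x v].  In this form the entries of the Laplacian no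
    longer depend on degrees, which the replacement of a vertex changes. *)
Lemma laplacianE (R : numFieldType) n (G : sgraph n) (x : 'cV[R]_n) u :
  (laplacian R G *m x) u 0 = \sum_(v | adj G u v) (x u 0 - x v 0).
Proof.
rewrite mxE (bigD1 u) //= mxE eqxx sumrB sum_adj_const; congr (_ + _).
rewrite -sumrN big_mkcond [RHS]big_mkcond /=; apply: eq_bigr => v _.
rewrite mxE eq_sym; case: eqP => [->|_]; first by rewrite adj_irr.
by case: ifP => _; rewrite ?mulN1r ?mul0r.
Qed.

Lemma laplacian_null_neighbors (R : numFieldType) n (G : sgraph n)
    (x : 'cV[R]_n) u :
    (forall v, adj G u v -> x v 0 = 0) ->
  (laplacian R G *m x) u 0 = (degree G u)%:R * x u 0.
Proof.
move=> x0; rewrite laplacianE -sum_adj_const.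
by apply: eq_bigr => v /x0 ->; rewrite subr0.
Qed.

(** The neighbors of a vertex of the new graph, sorted into old and inserted
    ones; both later computations start from this splitting. *)
Lemma laplacian_replaceE (R : numFieldType) n k (G : sgraph n) (i : 'I_n)
    (S : {set 'I_n}) (H : sgraph k) (y : 'cV[R]_n.-1) (z : 'cV[R]_k) :
    let Lyz := laplacian R (replace_vertex G i S H) *m col_mx y z in
  (forall m, Lyz (lshift k m) 0 =
     \sum_(b | adj G (lift i m) (lift i b)) (y m 0 - y b 0)
     + \sum_(j | lift i m \in S) (y m 0 - z j 0)) /\
  (forall j, Lyz (rshift n.-1 j) 0 =
     \sum_(b | lift i b \in S) (z j 0 - y b 0)
     + \sum_(j' | adj H j j') (z j 0 - z j' 0)).
Proof.
have splitl m : split (lshift k m) = inl m := unsplitK (inl m).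
have splitr j : split (rshift n.-1 j) = inr j := unsplitK (inr j).
split=> u; rewrite laplacianE big_split_ord /= /replace_adj ?splitl ?splitr.
  congr (_ + _); apply: eq_big => v; rewrite ?splitl ?splitr //.
    by rewrite !col_mxEu.
  by rewrite col_mxEu col_mxEd.
congr (_ + _); apply: eq_big => v; rewrite ?splitl ?splitr //.
  by rewrite col_mxEu col_mxEd.
by rewrite !col_mxEd.
Qed.

(** The terms indexed by the inserted vertices add up to the single term that
    the vertex [i] contributed, by the division of [x i] into [k] parts. *)
Lemma laplacian_replace_old (R : numFieldType) n k (G : sgraph n) (i : 'I_n)
    (H : sgraph k) (x : 'cV[R]_n) m :
    (0 < k)%N -> (forall v, adj G i v -> x v 0 = 0) ->
  (laplacian R (replace_vertex G i [set v | adj G i v] H)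
     *m replace_vector k i x) (lshift k m) 0
    = (laplacian R G *m x) (lift i m) 0.
Proof.
move=> k_gt0 x0; rewrite (laplacian_replaceE _ _ _ _ _ _).1 laplacianE.
(* The term of the deleted vertex is matched with the inserted vertices, and
   the terms of the other old vertices with themselves. *)
rewrite (sum_lift i) addrC mxE adj_sym inE; congr (_ + _).
  by apply: eq_bigr => b _; rewrite mxE.
case: ifP => [/x0 ->|_]; last by rewrite big_pred0_eq.
under eq_bigr do rewrite mxE sub0r.
rewrite sumrN sumr_const card_ord -[_ *+ k]mulr_natr sub0r divfK //.
by rewrite pnatr_eq0 -lt0n.
Qed.

(** All inserted vertices carry the same value, so the edges of [H] contribute
    nothing, whatever [H] is.  The rest of the sum runs over the neighbors that
    [i] had in [G], which is why the degree of [i] appears. *)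
Lemma laplacian_replace_new (R : numFieldType) n k (G : sgraph n) (i : 'I_n)
    (H : sgraph k) (x : 'cV[R]_n) j :
    (forall v, adj G i v -> x v 0 = 0) ->
  (laplacian R (replace_vertex G i [set v | adj G i v] H)
     *m replace_vector k i x) (rshift n.-1 j) 0
    = (degree G i)%:R * (x i 0 / k%:R).
Proof.
move=> x0; rewrite (laplacian_replaceE _ _ _ _ _ _).2.
rewrite [X in _ + X]big1 ?addr0; last by move=> j' _; rewrite !mxE subrr.
rewrite -sum_adj_const (sum_lift i) adj_irr add0r.
apply: eq_big => b; rewrite inE // => /x0 xb0.
by rewrite !mxE xb0 subr0.
Qed.

Theorem theorem4p5 (R : numFieldType) (n p k d : nat)
    (G : sgraph n) (H : sgraph k) (lambda : R) (x : 'cV[R]_n)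
    (i : 'I_n) (s : 'I_p -> 'I_n)
    (G_connected : connected_graph G)
    (x_eigen : eigenvector (laplacian R G) lambda x)
    (s_inj : injective s)
    (nbr_i : [set m | adj G i m] = [set s a | a : 'I_p])
    (s_soft : forall a : 'I_p, soft_node G lambda x (s a))
    (xi_neq0 : x i 0 != 0)
    (k_gt0 : (0 < k)%N)
    (H_regular : regular H d) :
  lambda = p%:R /\
  eigenvector (laplacian R (replace_vertex G i [set s a | a : 'I_p] H))
    p%:R (replace_vector k i x).
Proof.
have x0 v : adj G i v -> x v 0 = 0.
  move=> iv; have /imsetP[a _ ->] : v \in [set s a | a : 'I_p].
    by rewrite -nbr_i inE.
  by have [] := s_soft a.
have deg_i : degree G i = p by rewrite /degree nbr_i card_imset // card_ord.
have [_ Lx] := x_eigen.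
have lambdaE : lambda = p%:R.
  apply: (mulIf xi_neq0).
  by rewrite -deg_i -laplacian_null_neighbors // Lx mxE.
split=> //; split.
  (* The entry at an inserted vertex is [x i / k], nonzero in characteristic
     zero; such a vertex exists because [k] is positive. *)
  apply/eqP => /matrixP /(_ (rshift _ (Ordinal k_gt0)) 0) /eqP.
  rewrite col_mxEd !mxE mulf_eq0 invr_eq0 pnatr_eq0 (negPf xi_neq0).
  by rewrite -[k == 0%N]negbK -lt0n k_gt0.
apply/colP => u; rewrite -nbr_i [RHS]mxE -(splitK u).
case: (split u) => [m|j] /=.
  by rewrite laplacian_replace_old // Lx lambdaE col_mxEu !mxE.
by rewrite laplacian_replace_new // deg_i col_mxEd mxE.
Qed.
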